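(* Let $G_1$ be a graph and suppose that there are a positive integer $K$ and a vertex $w\in G_1$ such that every odd cycle in $G_1$ intersects the open ball $B:=B_{G_1}(w,K)$. Let $G_2$ be a non-trivial bounded graph without odd cycles. Then the direct product $G_1\times G_2$ is hyperbolic if and only if $G_1$ is hyperbolic.
   Context: Conventions. A graph $G$ (such as $G_1,G_2$) is a nonempty, connected, simple (no loops, no multiple edges), possibly infinite graph; every edge has length $1$, and $G$ is regarded as a geodesic metric space by identifying each edge isometrically with $[0,1]$ and using the shortest-path distance $d_G$ (so points of $G$ are vertices and interior points of edges). A graph is trivial if it has exactly one vertex, and bounded if it has finite diameter. A cycle is a simple closed curve (a closed path with no repeated vertices except first = last); it is odd if its length is odd. $B_G(w,r)=\{x\in G: d_G(x,w)<r\}$. Direct product: $G_1\times G_2$ has vertex set $V(G_1)\times V(G_2)$, and $(u_1,v_1)$, $(u_2,v_2)$ are adjacent iff $[u_1,u_2]\in E(G_1)$ and $[v_1,v_2]\in E(G_2)$. It may be disconnected. Hyperbolicity: in a geodesic metric space $X$, a geodesic triangle is the union of three geodesics $[x_1x_2],[x_2x_3],[x_3x_1]$; it is $\delta$-thin if each side is contained in the $\delta$-neighborhood of the union of the other two sides. $\delta(T)$ is the infimum of $\delta\ge 0$ such that $T$ is $\delta$-thin, $\delta(X):=\sup_T\delta(T)$ over all geodesic triangles $T$ in $X$, and $X$ is hyperbolic if $\delta(X)<\infty$. If $X$ has connected components $X_i$, then $\delta(X):=\sup_i\delta(X_i)$, and $X$ is hyperbolic if $\delta(X)<\infty$. *)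

(* Defs.v *)
From HB Require Import structures.
From mathcomp Require Import all_boot all_order all_algebra.
From mathcomp Require Import all_classical all_reals ereal.

Set Implicit Arguments.
Unset Strict Implicit.
Unset Printing Implicit Defensive.

Import Order.TTheory GRing.Theory Num.Theory.
Local Open Scope classical_set_scope.
Local Open Scope ring_scope.

(** * Simple graphs, possibly infinite, possibly disconnected *)

Record sgraph := SGraph {
  vertex :> eqType;
  adj : rel vertex;
  adj_sym : symmetric adj;
  adj_irr : irreflexive adj }.

Definition connected_graph (G : sgraph) : Prop :=
  inhabited G /\
  forall u v : G, exists p : seq G, path (@adj G) u p /\ last u p = v.

Definition trivial_graph (G : sgraph) : Prop :=
  exists v : G, forall u : G, u = v.

Section DirectProduct.
Variables G1 G2 : sgraph.

Definition dprod_adj : rel (G1 * G2)%type :=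
  fun x y => adj x.1 y.1 && adj x.2 y.2.

Lemma dprod_adj_sym : symmetric dprod_adj.
Proof. by move=> x y; rewrite /dprod_adj adj_sym [adj x.2 _]adj_sym. Qed.

Lemma dprod_adj_irr : irreflexive dprod_adj.
Proof. by move=> x; rewrite /dprod_adj adj_irr. Qed.

Definition direct_product : sgraph := SGraph dprod_adj_sym dprod_adj_irr.

End DirectProduct.

(** A cycle is listed by its vertices, the first one not being repeated at the
    end. The bound on the size excludes an edge run back and forth. *)
Definition graph_cycle (G : sgraph) (c : seq G) : Prop :=
  [/\ (2 < size c)%N, cycle (@adj G) c & uniq c].

Definition odd_cycle (G : sgraph) (c : seq G) : Prop :=
  graph_cycle c /\ odd (size c).

(** * The metric graph

    A point is given by its barycentric coordinates: the point at distance [t]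
    from [u] on the edge [uv] is [bary u v t], so that [bary u v t] and
    [bary v u (1 - t)] are the same function, and the ends of the edge are the
    vertices themselves. *)

Section MetricGraph.
Variables (R : realType) (G : sgraph).

Definition bary_vertex (v : G) : G -> R := fun z => (z == v)%:R.

Definition bary (u v : G) (t : R) : G -> R :=
  fun z => (1 - t) * bary_vertex u z + t * bary_vertex v z.

Definition is_point (x : G -> R) : Prop :=
  (exists v, x = bary_vertex v) \/
  (exists u v t, [/\ adj u v, 0 <= t <= 1 & x = bary u v t]).

Record point := Point { coord : G -> R; coordP : is_point coord }.

Definition vertex_point (v : G) : point :=
  Point (or_introl (ex_intro _ v erefl)).

Definition on_edge (x : point) (u v : G) (t : R) : Prop :=
  [/\ adj u v, 0 <= t <= 1 & coord x = bary u v t].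

(** [route x y l]: some concatenation of finitely many segments of edges leads
    from [x] to [y] and has length [l]. *)
Inductive route : point -> point -> R -> Prop :=
| route_nil x : route x x 0
| route_cons x y z u v s t l :
    on_edge x u v s -> on_edge y u v t -> route y z l ->
    route x z (`|s - t| + l).

(** The shortest-path distance, [+oo] between different components. *)
Definition gdist (x y : point) : \bar R :=
  ereal_inf [set l%:E | l in route x y].

Definition gball (x : point) (r : R) : set point :=
  [set y | (gdist y x < r%:E)%E].

Definition diameter : \bar R :=
  ereal_sup [set d | exists x y, d = gdist x y].

Definition bounded_graph : Prop := (diameter < +oo)%E.

Definition cycle_points (c : seq G) : set point :=
  [set x | exists u t, u \in c /\ on_edge x u (next c u) t].

(** * Hyperbolicity *)

Definition is_geodesic (x y : point) (S : set point) : Prop :=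
  exists (L : R) (g : R -> point),
    [/\ 0 <= L, g 0 = x, g L = y,
        forall s t, 0 <= s <= L -> 0 <= t <= L ->
          gdist (g s) (g t) = `|s - t|%:E
      & S = [set g s | s in [set s | 0 <= s <= L]]].

Definition gdist_set (x : point) (S : set point) : \bar R :=
  ereal_inf [set gdist x y | y in S].

Definition neighborhood (S : set point) (d : R) : set point :=
  [set x | (gdist_set x S <= d%:E)%E].

(** The union [A `|` B `|` C] is a geodesic triangle in [X]. *)
Definition geodesic_triangle (X A B C : set point) : Prop :=
  [/\ A `<=` X, B `<=` X, C `<=` X &
    exists x1 x2 x3,
      [/\ is_geodesic x1 x2 A, is_geodesic x2 x3 B & is_geodesic x3 x1 C]].

Definition thin (d : R) (A B C : set point) : Prop :=
  [/\ A `<=` neighborhood (B `|` C) d,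
      B `<=` neighborhood (C `|` A) d
    & C `<=` neighborhood (A `|` B) d].

Definition delta_triangle (A B C : set point) : \bar R :=
  ereal_inf [set d%:E | d in [set d | 0 <= d /\ thin d A B C]].

Definition delta_set (X : set point) : \bar R :=
  ereal_sup [set e | exists A B C,
    geodesic_triangle X A B C /\ e = delta_triangle A B C].

Definition component (x : point) : set point :=
  [set y | (gdist x y < +oo)%E].

Definition delta : \bar R :=
  ereal_sup [set delta_set (component x) | x in [set: point]].

Definition hyperbolic : Prop := (delta < +oo)%E.

End MetricGraph.

(* Main.v *)
(** A graph is hyperbolic if and only if its vertices satisfy Gromov's
    four-point inequality, which compares distances up to additive errors only;
    by a change of base point it need only be checked when one of the points
    is a fixed [w]. Now a walk in [G1 x G2] is a pair of walks of the same
    length, and the lengths of the walks between two given vertices of [G2]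
    have a fixed parity since [G2] is bipartite. So two vertices
    of [G1 x G2] are, up to the diameter of [G2], as far apart as their
    projections to [G1] when the parities of the distances in [G1] and [G2]
    agree. Otherwise they are joined through an odd detour in [G1], which has
    to pass near [w], and their distance is about [d(u, w) + d(w, v)]: the
    Gromov product based at [w] is then about zero. With this dichotomy the
    inequality based at [w] passes from [G1] to [G1 x G2] and back. *)

Require Import Defs.
From HB Require Import structures.
From mathcomp Require Import all_boot all_order all_algebra.
From mathcomp Require Import all_classical all_reals ereal.
From mathcomp Require Import zify ring lra.

Set Implicit Arguments.
Unset Strict Implicit.
Unset Printing Implicit Defensive.

Import Order.TTheory GRing.Theory Num.Theory.

(** * Walks, odd cycles and the four-point inequality *)

Section Walks.
Variable G : sgraph.
Implicit Types u v t : G.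

Definition walk n u v : Prop :=
  exists p, [/\ path (@adj G) u p, last u p = v & size p = n].

Definition linked u v : Prop := exists n, walk n u v.

Lemma walk0 u : walk 0 u u.
Proof. by exists [::]. Qed.

Lemma walk1 u v : adj u v -> walk 1 u v.
Proof. by move=> uv; exists [:: v]; rewrite /= uv. Qed.

Lemma walk_cat m n u v t : walk m u v -> walk n v t -> walk (m + n) u t.
Proof.
case=> p [up uv <-] [q [vq vt <-]]; exists (p ++ q).
by rewrite cat_path last_cat size_cat uv up vq vt.
Qed.

Lemma walkS n u v : walk n.+1 u v -> exists2 t, adj u t & walk n t v.
Proof.
case=> -[|t p] [] //= /andP[ut tp] tv [pn].
by exists t => //; exists p.
Qed.

Lemma walk_sym n u v : walk n u v -> walk n v u.
Proof.
elim: n u => [|n IH] u.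
  by case=> -[|? ?] [] //= _ -> _; apply: walk0.
move=> /walkS[t ut /IH tv]; rewrite -addn1; apply: walk_cat tv _.
by apply: walk1; rewrite adj_sym.
Qed.

(** Going back and forth along an edge costs two steps; this is how walks of equal parity are later
    brought to a common length. *)
Lemma walk_pad n k u t v : adj u t -> walk n u v -> walk (n + k.*2) u v.
Proof.
move=> ut; elim: k => [|k IH] uv; first by rewrite addn0.
have ->: n + k.+1.*2 = 1 + (1 + (n + k.*2)) by lia.
apply: walk_cat (walk1 ut) _; apply: walk_cat (IH uv).
by apply: walk1; rewrite adj_sym.
Qed.

Lemma walk_back n u t : adj u t -> walk n u (if odd n then t else u).
Proof.
move=> ut; rewrite -{1}[n]odd_double_half.
apply: (@walk_pad _ _ _ t) => //; case: odd; [exact: walk1 | exact: walk0].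
Qed.

Lemma linked_refl u : linked u u.
Proof. by exists 0; apply: walk0. Qed.

Lemma linked_sym u v : linked u v -> linked v u.
Proof. by move=> [n /walk_sym uv]; exists n. Qed.

Lemma linked_trans v u t : linked u v -> linked v t -> linked u t.
Proof. by case=> m uv [n vt]; exists (m + n); apply: walk_cat uv vt. Qed.

(** Between unlinked vertices the value is the default 0, whence the [linked] assumptions below. *)
Definition vdist u v : nat :=
  match pselect (exists n, `[< walk n u v >]) with
  | left h => ex_minn h
  | right _ => 0
  end.

Lemma vdist_walk u v : linked u v -> walk (vdist u v) u v.
Proof.
rewrite /vdist; case: pselect => [h _|+ [n uv]].
  by case: ex_minnP => m /asboolP.
by case; exists n; apply/asboolP.
Qed.

Lemma vdist_min n u v : walk n u v -> vdist u v <= n.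
Proof.
rewrite /vdist; case: pselect => // h uv.
by case: ex_minnP => m _; apply; apply/asboolP.
Qed.

Lemma vdist_unlinked u v : ~ linked u v -> vdist u v = 0.
Proof.
move=> uv; rewrite /vdist; case: pselect => // h.
by exfalso; case: h => n /asboolP h; apply: uv; exists n.
Qed.

Lemma vdist_refl u : vdist u u = 0.
Proof. by apply/eqP; rewrite -leqn0 vdist_min//; apply: walk0. Qed.

Lemma vdist_sym u v : vdist u v = vdist v u.
Proof.
case: (pselect (linked u v)) => uv.
  have vu := linked_sym uv.
  by apply/eqP; rewrite eqn_leq !vdist_min//; apply/walk_sym/vdist_walk.
by rewrite !vdist_unlinked// => /linked_sym.
Qed.

Lemma vdist_triangle v u t : linked u v -> linked v t ->
  vdist u t <= vdist u v + vdist v t.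
Proof. by move=> uv vt; apply/vdist_min/walk_cat; apply: vdist_walk. Qed.

(** Induction on the length: a repeated vertex splits a closed walk into two shorter ones, one of
    which is odd. *)
Lemma odd_cyclic_walk (s : seq G) : cycle (@adj G) s -> odd (size s) ->
  exists2 c, odd_cycle c & {subset c <= s}.
Proof.
have [n] := ubnP (size s); elim: n s => // n IH s sn sC sO.
case: (boolP (uniq s)) => [sU|sU].
  exists s => //; split=> //; split=> //.
  case: s sC sO {sn sU} => [|x [|y [|z s]]] //=.
  by rewrite adj_irr.
case: s sC sO sn sU => // x0 s0; set s := x0 :: s0 => sC sO sn.
move=> /(uniqPn x0)[i [j [ij js eij]]].
set x := nth x0 s i in eij *.
have s1E : drop i s = x :: drop i.+1 s.
  by rewrite (drop_nth x0)// (ltn_trans ij).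
have rC : cycle (@adj G) (rot i s) by rewrite rot_cycle.
(* Rotated to start at the repeated vertex [x], the list falls into the closed walks [x :: a] and
   [x :: b]. *)
have [a [b rE]] : exists a b, rot i s = x :: a ++ x :: b.
  exists (take (j - i.+1) (drop i.+1 s)), (drop j.+1 s ++ take i s).
  rewrite /rot s1E cat_cons; congr cons.
  rewrite -{1}[drop i.+1 s](cat_take_drop (j - i.+1)) -!catA -cat_cons.
  congr cat.
  by rewrite drop_drop subnK// (drop_nth x0)// -eij.
have sE : size s = (size a).+1 + (size b).+1.
  by rewrite -(size_rot i) rE /= size_cat /=; lia.
have memE : rot i s =i s by apply: mem_rot.
move: rC; rewrite rE /= rcons_cat rcons_cons cat_path /= => /and3P[pa ax pb].
have [oa|ob] : odd (size a).+1 \/ odd (size b).+1.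
  by move: sO; rewrite sE oddD; case: odd; [left|right].
- have [||//|c cO cs] := IH (x :: a).
  + by move: sn; rewrite sE /=; lia.
  + by rewrite /= rcons_path pa.
  + exists c => // y /cs ya; rewrite -memE rE.
    by move: ya; rewrite !inE mem_cat => /orP[->|->]; rewrite ?orbT.
- have [|//|//|c cO cs] := IH (x :: b).
    by move: sn; rewrite sE /=; lia.
  exists c => // y /cs ya; rewrite -memE rE.
  by move: ya; rewrite !inE mem_cat inE => /orP[->|->]; rewrite ?orbT.
Qed.

Lemma odd_closed_walk u p : path (@adj G) u p -> last u p = u ->
  odd (size p) -> exists2 c, odd_cycle c & {subset c <= p}.
Proof.
move=> up uu po; apply: odd_cyclic_walk => //.
case/lastP: p up uu po => // p v; rewrite last_rcons => up uv _.
by rewrite uv in up *; rewrite -rot1_cons rot_cycle.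
Qed.

(** Otherwise one walk followed by the reverse of the other is an odd closed walk, which contains an
    odd cycle. *)
Lemma walk_parity m n u v : ~ (exists c : seq G, odd_cycle c) ->
  walk m u v -> walk n u v -> odd m = odd n.
Proof.
move=> noodd uv /walk_sym vu.
have [p [up uu pE]] := walk_cat uv vu.
apply/eqP/contraT => mn; exfalso; apply: noodd.
have [|c cO _] := odd_closed_walk up uu; last by exists c.
by rewrite pE oddD; move: mn; do 2 case: odd.
Qed.

Lemma walk_through u p q : path (@adj G) u p -> q \in p ->
  exists i j, [/\ walk i u q, walk j q (last u p) & i + j = size p].
Proof.
move=> + qp; case/splitPr: qp => a b.
rewrite cat_path last_cat size_cat /= => /and3P[ua aq qb].
exists (size a).+1, (size b); split; last by lia.
  by exists (rcons a q); rewrite rcons_path last_rcons size_rcons ua.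
by exists b.
Qed.

(** The three walks form an odd closed walk, so they contain an odd cycle and a vertex [q] within
    [K] of [w]. The walk through [q] leads from [q] to both of its ends, and going on from [q] to
    [w] costs at most [K] for each end. *)
Lemma odd_triangle_near K w l1 l2 l3 x y z :
  (forall u v, linked u v) ->
  (forall c, odd_cycle c -> exists2 q, q \in c & vdist q w <= K) ->
  walk l1 x y -> walk l2 y z -> walk l3 z x -> odd (l1 + l2 + l3) ->
  [\/ vdist x w + vdist y w <= l1 + K.*2,
      vdist y w + vdist z w <= l2 + K.*2 |
      vdist z w + vdist x w <= l3 + K.*2].
Proof.
move=> conn near [p1 [xp py sp]] [p2 [yp pz sq]] [p3 [zp px sr]] o.
have [|||c cO cp] := @odd_closed_walk x (p1 ++ p2 ++ p3).
- by rewrite !cat_path py pz xp yp zp.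
- by rewrite !last_cat py pz.
- by rewrite !size_cat addnA sp sq sr.
have [q /cp + qw] := near c cO.
have through u p v : path (@adj G) u p -> last u p = v -> q \in p ->
    vdist u w + vdist v w <= size p + K.*2.
  move=> up uv /(walk_through up)[i [j [ui jv <-]]]; rewrite uv in jv.
  have := vdist_triangle (conn u q) (conn q w).
  have := vdist_triangle (conn v q) (conn q w).
  have := vdist_min ui; have := vdist_min (walk_sym jv); lia.
rewrite !mem_cat => /or3P[] qp.
- by apply: Or31; rewrite -sp; exact: through.
- by apply: Or32; rewrite -sq; exact: through.
- by apply: Or33; rewrite -sr; exact: through.
Qed.

(** Restricted to one component at a time, since the product may be disconnected. *)
Definition fourpoint (c : nat) : Prop := forall x y z t,
  linked x y -> linked x z -> linked x t ->
  vdist x y + vdist z t <=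
    maxn (vdist x z + vdist y t) (vdist x t + vdist y z) + c.

(** Change of base point. Written in distances, the hypothesis is [(x|z) >= min((x|y), (y|z)) - c/2]
    for Gromov products at [w], where [w] may depend on the component. Four instances combine to the
    general inequality, at the price of doubling [c]. *)
Lemma fourpoint_based (c : nat) :
  (forall x, exists2 w, linked x w & forall x y z,
     linked x w -> linked y w -> linked z w ->
     vdist x z + vdist y w <=
       maxn (vdist x y + vdist z w) (vdist y z + vdist x w) + c) ->
  fourpoint c.*2.
Proof.
move=> based x y z t xy xz xt.
have [w xw H] := based x.
have yw := linked_trans (linked_sym xy) xw.
have zw := linked_trans (linked_sym xz) xw.
have tw := linked_trans (linked_sym xt) xw.
have := H x z y xw zw yw; have := H z x t zw xw tw.
have := H x t y xw tw yw; have := H z y t zw yw tw.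
rewrite !(vdist_sym y x, vdist_sym z x, vdist_sym t x, vdist_sym z y,
  vdist_sym t y, vdist_sym t z).
lia.
Qed.

End Walks.

(** * Distances in the direct product *)

Section ProductDistance.
Variables G1 G2 : sgraph.
Local Notation H := (direct_product G1 G2).
Implicit Types x y z : H.

Lemma walk_prod n x y : walk n x y <-> walk n x.1 y.1 /\ walk n x.2 y.2.
Proof.
elim: n x => [|n IH] x.
  split=> [[[|? ?] [] //= _ <- _]|[]]; first by split; apply: walk0.
  case: x y => [u a] [v b] /= [[|? ?] [] //= _ -> _] [[|? ?] [] //= _ -> _].
  exact: walk0.
split=> [/walkS[z /andP[xz1 xz2] /IH[zy1 zy2]]|].
  by split; rewrite -add1n; [apply: walk_cat zy1|apply: walk_cat zy2];
     apply: walk1.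
move=> [/walkS[t xt ty] /walkS[s xs sy]]; rewrite -add1n.
have xts : walk 1 x ((t, s) : H) by apply: walk1; rewrite /= /dprod_adj xt xs.
by apply: walk_cat xts _; apply/IH.
Qed.

Lemma vdist_fst_le x y : linked x y -> vdist x.1 y.1 <= vdist x y.
Proof. by move=> /vdist_walk/walk_prod[xy _]; apply: vdist_min. Qed.

Variables (D K : nat) (w : G1) (b0 b1 : G2).
Hypotheses (conn1 : forall u v : G1, linked u v)
  (conn2 : forall u v : G2, linked u v)
  (near : forall c : seq G1, odd_cycle c ->
     exists2 q, q \in c & vdist q w <= K)
  (noodd : ~ exists c : seq G2, odd_cycle c)
  (diam2 : forall a b : G2, vdist a b <= D)
  (b01 : adj b0 b1).

Lemma odd_walk_snd n (a b : G2) : walk n a b -> odd n = odd (vdist a b).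
Proof. by move=> ab; apply: (walk_parity noodd ab); apply: vdist_walk. Qed.

Lemma odd_vdist_prod x y : linked x y -> odd (vdist x y) = odd (vdist x.2 y.2).
Proof. by move=> /vdist_walk/walk_prod[_ /odd_walk_snd]. Qed.

(** Both coordinate walks are padded to length [max(l, d)], with [d] the distance in [G2], as [l]
    and [d] have the same parity. The edges to go back and forth on come from a walk joining [x] to
    [y]; if it is empty, [x = y]. *)
Lemma vdist_prod_le l x y : linked x y -> walk l x.1 y.1 ->
  odd l = odd (vdist x.2 y.2) -> vdist x y <= l + D.
Proof.
move=> [n /walk_prod[xy1 xy2]] l1 l2.
case: n xy1 xy2 => [|n].
  case: x y l1 l2 => [u a] [v b] /= _ _.
  move=> [[|? ?] [] //= _ <- _] [[|? ?] [] //= _ <- _].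
  by rewrite vdist_refl.
move=> /walkS[t xt _] /walkS[s xs _].
have d2 := vdist_walk (conn2 x.2 y.2).
apply: (@leq_trans (maxn l (vdist x.2 y.2))); last first.
  by have := diam2 x.2 y.2; lia.
apply: vdist_min; apply/walk_prod; split.
  have -> : maxn l (vdist x.2 y.2) = l + ((vdist x.2 y.2 - l)./2).*2 by lia.
  exact: walk_pad xt l1.
have -> : maxn l (vdist x.2 y.2) =
    vdist x.2 y.2 + ((l - vdist x.2 y.2)./2).*2 by lia.
exact: walk_pad xs d2.
Qed.

Lemma vdist_prod_even x y : linked x y ->
  odd (vdist x.1 y.1) = odd (vdist x.2 y.2) ->
  vdist x y <= vdist x.1 y.1 + D.
Proof. by move=> xy; apply: vdist_prod_le => //; apply: vdist_walk. Qed.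

(* A walk whose parity is not that of the distance closes up with a geodesic
   into an odd closed walk, which has to come near [w] *)
Lemma vdist_prod_odd x y : linked x y ->
  odd (vdist x.1 y.1) != odd (vdist x.2 y.2) ->
  vdist x.1 w + vdist y.1 w <= vdist x y + K.*2.
Proof.
move=> xy; rewrite -odd_vdist_prod// => o.
have /walk_prod[xy1 _] := vdist_walk xy.
have xx := vdist_walk (conn1 y.1 x.1).
have := vdist_fst_le xy; rewrite (vdist_sym x.1) in o *.
have [|||] := odd_triangle_near conn1 near xy1 xx (walk0 x.1); last 3 first.
- lia.
- lia.
- have := vdist_triangle (conn1 y.1 x.1) (conn1 x.1 w); lia.
by rewrite addn0 oddD; move: o; do 2 case: odd.
Qed.

(** If there is an odd closed walk at [w], appending it corrects a wrong parity at a fixed cost.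
    Otherwise all walks from a given vertex to [w] have the same parity, and nothing needs
    correction. *)
Lemma vdist_prod_base : exists M, forall x b, linked x (w, b) ->
  vdist x (w, b : G2) <= vdist x.1 w + M.
Proof.
have [[n nO nw]|noO] := pselect (exists2 n, odd n & walk n w w).
  exists (n + D) => x b xw.
  have d1 := vdist_walk (conn1 x.1 w).
  have [e|ne] := eqVneq (odd (vdist x.1 w)) (odd (vdist x.2 b)).
    by have := vdist_prod_even xw e; rewrite /=; lia.
  rewrite addnA; apply: vdist_prod_le xw (walk_cat d1 nw) _ => /=.
  by rewrite oddD nO; move: ne; do 2 case: odd.
exists D => x b xw; apply: vdist_prod_even => //=.
have /walk_prod[/= m1 /odd_walk_snd <-] := vdist_walk xw.
apply/eqP/contraT => o; exfalso; apply: noO.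
exists (vdist x (w, b) + vdist x.1 w).
  by rewrite oddD; move: o; do 2 case: odd.
by apply: walk_cat (walk_sym m1) _; apply: vdist_walk.
Qed.

(** While the first coordinate walks to [w], the second goes back and forth along an edge. *)
Lemma linked_base x : exists b, linked x (w, b).
Proof.
have [n xw] := conn1 x.1 w.
have [t st] : exists t, adj x.2 t.
  have [[|m]] := conn2 x.2 b0.
    by case=> -[|? ?] [] //= _ -> _; exists b1.
  by move=> /walkS[t xt _]; exists t.
exists (if odd n then t else x.2), n.
by apply/walk_prod; split=> //; apply: walk_back.
Qed.

Lemma fourpoint_prod : (exists c, fourpoint G1 c) -> exists c, fourpoint H c.
Proof.
move=> [c fp]; have [M hM] := vdist_prod_base.
exists (c + D + 4 * K + 3 * M).*2; apply: fourpoint_based => x.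
have [b xw] := linked_base x; exists (w, b) => // {xw}x y z xw yw zw.
have xy := linked_trans xw (linked_sym yw).
have yz := linked_trans yw (linked_sym zw).
have xz := linked_trans xw (linked_sym zw).
have := (hM _ _ xw, hM _ _ yw, hM _ _ zw) => -[[]].
have /= := (vdist_fst_le xw, vdist_fst_le yw, vdist_fst_le zw) => -[[]].
have := (vdist_fst_le xy, vdist_fst_le yz, vdist_fst_le xz) => -[[]].
have := vdist_triangle xw (linked_sym zw); rewrite (@vdist_sym H (w, b) z).
have := fp x.1 z.1 y.1 w (conn1 _ _) (conn1 _ _) (conn1 _ _).
rewrite (vdist_sym z.1 y.1).
(* If the parities disagree for [x, y] or for [y, z], the Gromov product of that pair at [w] is
   about zero, and it is enough to bound [d(x, z)] by the detour through [w]. *)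
have [oxy|/(vdist_prod_odd xy)] :=
  eqVneq (odd (vdist x.1 y.1)) (odd (vdist x.2 y.2)); last by lia.
have [oyz|/(vdist_prod_odd yz)] :=
  eqVneq (odd (vdist y.1 z.1)) (odd (vdist y.2 z.2)); last by lia.
have [oxz|oxz] := eqVneq (odd (vdist x.1 z.1)) (odd (vdist x.2 z.2)).
  by have := vdist_prod_even xz oxz; lia.
(* Here the triangle of the projections has odd perimeter, so the Gromov product of one of its sides
   is about zero. If that side is [xz], the inequality in [G1] passes this on to one of the other
   two. *)
have := odd_triangle_near conn1 near (vdist_walk (conn1 x.1 y.1))
  (vdist_walk (conn1 y.1 z.1)) (walk_sym (vdist_walk (conn1 x.1 z.1))).
case; [|lia..].
have := odd_walk_snd (walk_cat (vdist_walk (conn2 x.2 y.2))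
  (vdist_walk (conn2 y.2 z.2))).
by move: oxz; rewrite !oddD -oxy -oyz => + ->; do 2 case: odd.
Qed.

Lemma fourpoint_fst : (exists c, fourpoint H c) -> exists c, fourpoint G1 c.
Proof.
(* Lifting [x], [y], [z] along the edge [b0 b1] keeps [d(x, y)], [d(y, z)] and
   [d(y, w)]; the distances [d(x, w)] and [d(z, w)] grow by at most [M], and
   [d(x, z)] can only grow, which is harmless on the left-hand side *)
move=> [c fp]; have [M hM] := vdist_prod_base.
pose b n := if odd n then b1 else b0.
have walkb m n : walk m (b n) (b (n + m)).
  have := @walk_back _ m (b n) (b n.+1).
  rewrite /b oddD /=; case: odd => /=; last by case: odd; apply.
  by rewrite adj_sym; case: odd; apply.
exists (c + M.*2).*2; apply: fourpoint_based => x; exists w => //.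
move=> {}x y z _ _ _.
(* The indices of [b] are walking times, chosen so that geodesics from [y] to [w], [x] to [y] and
   [y] to [z] lift to walks of the same lengths. *)
pose y' : H := (y, b (vdist y w)).
pose x' : H := (x, b (vdist y w + vdist x y)).
pose z' : H := (z, b (vdist y w + vdist y z)).
have yw' : walk (vdist y w) y' (w, b 0).
  apply/walk_prod; split; first exact: vdist_walk.
  by apply: walk_sym; apply: walkb.
have xy' : walk (vdist x y) x' y'.
  apply/walk_prod; split; first exact: vdist_walk.
  by apply: walk_sym; apply: walkb.
have yz' : walk (vdist y z) y' z'.
  apply/walk_prod; split; first exact: vdist_walk.
  exact: walkb.
have yw : linked y' (w, b 0) by exists (vdist y w).
have xy : linked x' y' by exists (vdist x y).
have yz : linked y' z' by exists (vdist y z).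
have xw := linked_trans xy yw; have zw := linked_trans (linked_sym yz) yw.
have xz := linked_trans xy yz.
have := fp x' z' y' (w, b 0) xz xy xw.
rewrite (vdist_sym z' y').
have := vdist_fst_le xz; have := vdist_fst_le yw.
have := hM _ _ xw; have := hM _ _ zw.
have := vdist_min xy'; have := vdist_min yz'.
rewrite /=; lia.
Qed.

End ProductDistance.

Local Open Scope classical_set_scope.
Local Open Scope ring_scope.

(** * The metric graph *)

Section Distance.
Variables (R : realType) (G : sgraph).
Local Notation pt := (Defs.point R G).
Local Notation vx := (@vertex_point R G).
Local Notation coord := (@Defs.coord R G).
Implicit Types (x y z : pt) (u v w : G) (s t l m : R) (f : G -> R).

Lemma point_eq x y : coord x = coord y -> x = y.
Proof.
case: x y => [x hx] [y hy] /= xy; case: y / xy hy => hy.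
by congr Point; apply: Prop_irrelevance.
Qed.

Lemma baryC u v t : bary v u (1 - t) = bary u v t.
Proof. by apply/funext => z; rewrite /bary; ring. Qed.

Lemma bary0 u v : bary u v 0 = bary_vertex R u.
Proof. by apply/funext => z; rewrite /bary; ring. Qed.

Lemma on_edge0 u v : adj u v -> on_edge (vx u) u v 0.
Proof. by move=> uv; split; rewrite ?lexx ?ler01 ?bary0. Qed.

Lemma on_edge1 u v : adj u v -> on_edge (vx v) u v 1.
Proof.
by move=> uv; split; rewrite ?lexx ?ler01 // -baryC subrr bary0.
Qed.

Lemma route_edge x y u v s t : on_edge x u v s -> on_edge y u v t ->
  route x y `|s - t|.
Proof.
by move=> xs yt; rewrite -[`|_|]addr0; apply: route_cons xs yt (route_nil y).
Qed.

Lemma route_ge0 x y l : route x y l -> 0 <= l.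
Proof. by elim=> // *; rewrite addr_ge0. Qed.

Lemma route_cat x y z l m : route x y l -> route y z m -> route x z (l + m).
Proof.
move=> xy; elim: xy z m => [? ? ? ?|a b c u v s t k xs yt _ IH z m cz].
  by rewrite add0r.
by rewrite -addrA; apply: route_cons xs yt (IH _ _ cz).
Qed.

Lemma route_sym x y l : route x y l -> route y x l.
Proof.
elim=> [?|a b c u v s t k xs yt _ IH]; first exact: route_nil.
by rewrite addrC distrC; apply: route_cat IH (route_edge yt xs).
Qed.

Definition joined x y : Prop := exists l, route x y l.

Lemma joined_refl x : joined x x.
Proof. by exists 0; apply: route_nil. Qed.

Lemma joined_sym x y : joined x y -> joined y x.
Proof. by case=> l /route_sym; exists l. Qed.

Lemma joined_trans y x z : joined x y -> joined y z -> joined x z.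
Proof. by case=> l xy [m yz]; exists (l + m); apply: route_cat xy yz. Qed.

(* junk value 0 when [x] and [y] are not joined, hence no triangle inequality
   without such assumptions *)
Definition rdist x y : R := inf [set l | route x y l].

Let has_lbound_route x y : has_lbound [set l | route x y l].
Proof. by exists 0 => l /route_ge0. Qed.

Lemma gdistE x y : joined x y -> gdist x y = (rdist x y)%:E.
Proof. by move=> xy; apply: ereal_inf_EFin (has_lbound_route x y) xy. Qed.

Lemma gdist_joined x y : (gdist x y < +oo)%E <-> joined x y.
Proof.
split=> [|xy]; last by rewrite gdistE ?ltry.
by case/ereal_inf_lt => _ [l xy _] _; exists l.
Qed.

Lemma rdist_le x y l : route x y l -> rdist x y <= l.
Proof. exact: ge_inf (has_lbound_route x y) l. Qed.

Lemma rdist_lt x y e : joined x y -> 0 < e ->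
  exists2 l, route x y l & l < rdist x y + e.
Proof.
move=> xy e0; apply: inf_adherent e0 _; split=> //; exact: has_lbound_route.
Qed.

Lemma le_rdist x y m : joined x y -> (forall l, route x y l -> m <= l) ->
  m <= rdist x y.
Proof. by move=> xy H; apply: lb_le_inf. Qed.

Lemma rdist_ge0 x y : joined x y -> 0 <= rdist x y.
Proof. by move=> xy; apply: le_rdist => // l /route_ge0. Qed.

Lemma rdist_refl x : rdist x x = 0.
Proof.
apply/eqP; rewrite eq_le rdist_ge0 ?andbT; last exact: joined_refl.
exact/rdist_le/route_nil.
Qed.

Lemma rdist_sym x y : rdist x y = rdist y x.
Proof.
by congr inf; apply/seteqP; split=> l /route_sym.
Qed.

Lemma rdist_triangle y x z : joined x y -> joined y z ->
  rdist x z <= rdist x y + rdist y z.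
Proof.
move=> xy yz; apply/ler_addgt0Pr => e e0.
have e2 : 0 < e / 2 by lra.
have [l xl ?] := rdist_lt xy e2; have [m ym ?] := rdist_lt yz e2.
have := rdist_le (route_cat xl ym); lra.
Qed.

(* The affine extension of [f] to the edges. As a weighted sum of values of
   [f], it depends on the coordinates only *)
Definition interp f x : R :=
  xget 0 [set r | exists u v t,
    coord x = bary u v t /\ r = (1 - t) * f u + t * f v].

Let bary_sum f (S : seq G) u v t : uniq S -> u \in S -> v \in S ->
  \sum_(z <- S) bary u v t z * f z = (1 - t) * f u + t * f v.
Proof.
move=> SU uS vS.
have sum1 a : a \in S -> \sum_(z <- S) bary_vertex R a z * f z = f a.
  move=> aS; rewrite (bigD1_seq a)//= /bary_vertex eqxx mul1r big1 ?addr0//.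
  by move=> z /negbTE ->; rewrite mul0r.
rewrite -(sum1 _ uS) -(sum1 _ vS) !mulr_sumr -big_split /=.
by apply: eq_bigr => z _; rewrite /bary; ring.
Qed.

Lemma interpE f x u v t : coord x = bary u v t ->
  interp f x = (1 - t) * f u + t * f v.
Proof.
move=> xE; apply: xget_unique; first by exists u, v, t.
move=> _ [u' [v' [t' [xE' ->]]]].
(* Two descriptions of a point are compared as sums over all the vertices involved, where only the
   coordinates enter. *)
set S := undup [:: u; v; u'; v'].
have SU : uniq S := undup_uniq _.
rewrite -(@bary_sum f S)// ?mem_undup ?inE ?eqxx ?orbT//.
rewrite -(@bary_sum f S)// ?mem_undup ?inE ?eqxx ?orbT//.
by rewrite -xE -xE'.
Qed.

Lemma interp_vertex f u : interp f (vx u) = f u.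
Proof.
by rewrite (@interpE _ _ u u 0) ?bary0//; ring.
Qed.

(** On each edge [interp f] is affine with slope at most [k]. Lower bounds on the lengths of routes
    come from here. *)
Lemma interp_route f k x y l : (forall u v, adj u v -> `|f u - f v| <= k) ->
  route x y l -> `|interp f x - interp f y| <= k * l.
Proof.
move=> fk; elim=> [?|a b c u v s t m [uv s01 aE] [_ t01 bE] _ IH].
  by rewrite subrr normr0 mulr0.
rewrite (interpE f aE); apply: (le_trans (ler_distD (interp f b) _ _)).
rewrite mulrDr lerD// (interpE f bE).
have -> : (1 - s) * f u + s * f v - ((1 - t) * f u + t * f v) =
  (t - s) * (f u - f v) by ring.
rewrite normrM distrC mulrC ler_wpM2r// fk//.
Qed.

(** The indicator function of the component of [u] is constant along edges, so [interp_route]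
    applies with constant 0. *)
Lemma joined_linked u v : joined (vx u) (vx v) -> linked u v.
Proof.
case=> l uv; pose f (z : G) : R := `[< linked u z >]%:R.
have fC : forall a b, adj a b -> `|f a - f b| <= 0.
  move=> a b ab; suff -> : f a = f b by rewrite subrr normr0.
  rewrite /f; congr (nat_of_bool _)%:R; apply: asbool_equiv_eq.
  have lab : linked a b by exists 1%N; apply: walk1.
  split=> [ua|ub]; first exact: linked_trans lab.
  exact: linked_trans (linked_sym lab).
have := interp_route fC uv.
rewrite !interp_vertex mul0r normr_le0 subr_eq0 /f => /eqP.
rewrite asboolT; last exact: linked_refl.
by case: asboolP => // _ /eqP; rewrite oner_eq0.
Qed.

Lemma vdist_lipschitz w u v : adj u v ->
  `|(vdist u w)%:R - (vdist v w)%:R| <= 1 :> R.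
Proof.
move=> uv; have luv : linked u v by exists 1%N; apply: walk1.
have uv1 := vdist_min (walk1 uv); have vu1 := vdist_min (walk_sym (walk1 uv)).
have [uw|uw] := pselect (linked u w); last first.
  rewrite !vdist_unlinked ?subrr ?normr0// => vw.
  by apply: uw; apply: linked_trans vw.
have vw := linked_trans (linked_sym luv) uw.
have := vdist_triangle luv vw; have := vdist_triangle (linked_sym luv) uw.
move=> h1 h2; rewrite ler_distl; apply/andP; split.
  by rewrite lerBlDr natr1 ler_nat; lia.
by rewrite natr1 ler_nat; lia.
Qed.

Lemma route_walk n u v : walk n u v -> route (vx u) (vx v) n%:R.
Proof.
elim: n u => [|n IH] u.
  by case=> -[|? ?] [] //= _ -> _; apply: route_nil.
move=> /walkS[t ut /IH tv]; rewrite -natr1 addrC.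
apply: route_cat tv; have := route_edge (on_edge0 ut) (on_edge1 ut).
by rewrite sub0r normrN1.
Qed.

Lemma linked_joined u v : linked u v -> joined (vx u) (vx v).
Proof. by case=> n /route_walk; exists n%:R. Qed.

Lemma rdist_vertex u v : linked u v -> rdist (vx u) (vx v) = (vdist u v)%:R.
Proof.
move=> uv; apply/eqP; rewrite eq_le rdist_le/=; last first.
  exact/route_walk/vdist_walk.
apply: le_rdist; first exact: linked_joined.
(* The distance to [v] is 1-Lipschitz and goes from [vdist u v] to 0 along the route. *)
move=> l /(interp_route (@vdist_lipschitz v)).
rewrite !interp_vertex vdist_refl mul1r subr0; apply: le_trans.
exact: ler_norm.
Qed.

Lemma near_vertex x : exists2 v, joined x (vx v) & rdist x (vx v) <= 1.
Proof.
case: (coordP x) => [[v xE]|[u [v [t [uv t01 xE]]]]].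
  by exists v; rewrite (point_eq (xE : coord x = coord (vx v)));
    [apply: joined_refl|rewrite rdist_refl].
have xv : route x (vx u) `|t - 0|.
  by apply: (@route_edge _ _ u v) => //; apply: on_edge0.
exists u; first by exists `|t - 0|.
apply: (le_trans (rdist_le xv)); rewrite subr0.
by case/andP: t01 => t0 t1; rewrite ger0_norm.
Qed.

End Distance.

(** * Geodesics, and their existence between vertices *)

Section Geodesics.
Variables (R : realType) (G : sgraph).
Local Notation pt := (Defs.point R G).
Local Notation vx := (@vertex_point R G).
Implicit Types (p q x y z : pt) (u v w : G) (s t l m : R) (S : set pt).

Lemma gdist_fin x y l : gdist x y = l%:E -> joined x y /\ rdist x y = l.
Proof.
move=> xy; have j : joined x y by apply/gdist_joined; rewrite xy ltry.
by split=> //; move: xy; rewrite gdistE// => -[].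
Qed.

Lemma geodesic_param x y S : is_geodesic x y S -> exists g : R -> pt,
  [/\ g 0 = x, g (rdist x y) = y,
    forall s t, 0 <= s <= rdist x y -> 0 <= t <= rdist x y ->
      joined (g s) (g t) /\ rdist (g s) (g t) = `|s - t|
    & S = [set g s | s in [set s | 0 <= s <= rdist x y]]].
Proof.
move=> [L [g [L0 g0 gL gE ->]]].
have LL : 0 <= L <= L by rewrite L0 lexx.
have L00 : (0 : R) <= 0 <= L by rewrite lexx.
have [_] := gdist_fin (gE _ _ L00 LL).
rewrite sub0r normrN ger0_norm// g0 gL => ->.
by exists g; split=> // s t sL tL; apply/gdist_fin/gE.
Qed.

Lemma geodesic_mem x y S p : is_geodesic x y S -> S p ->
  [/\ joined x p, joined p y & rdist x p + rdist p y = rdist x y].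
Proof.
case/geodesic_param => g [g0 gL gE ->] [s /= sL <-].
have L0 : 0 <= rdist x y by case/andP: sL; apply: le_trans.
have LL : 0 <= rdist x y <= rdist x y by rewrite L0 lexx.
have L00 : (0 : R) <= 0 <= rdist x y by rewrite lexx.
have [xp xpE] := gE _ _ L00 sL; have [py pyE] := gE _ _ sL LL.
rewrite g0 in xp xpE; rewrite gL in py pyE.
split=> //; rewrite xpE pyE sub0r normrN.
by case/andP: sL => s0 sL; rewrite ger0_norm// ler0_norm ?subr_le0//; ring.
Qed.

Lemma geodesic_point x y S s : is_geodesic x y S -> 0 <= s <= rdist x y ->
  exists p, [/\ S p, joined x p, joined p y, rdist x p = s
    & rdist p y = rdist x y - s].
Proof.
move=> gS sL; have [g [g0 gL gE SE]] := geodesic_param gS.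
have Sp : S (g s) by rewrite SE; exists s.
have [xp py xpy] := geodesic_mem gS Sp.
have L00 : (0 : R) <= 0 <= rdist x y.
  by rewrite lexx; case/andP: sL; apply: le_trans.
have [_] := gE _ _ L00 sL; rewrite g0 sub0r normrN => xpE.
move: xpE; rewrite ger0_norm; last by case/andP: sL.
by move=> xpE; exists (g s); split=> //; rewrite -xpy xpE; ring.
Qed.

Lemma geodesic_joined x y S : is_geodesic x y S -> joined x y.
Proof.
case=> [L [g [L0 <- <- gE _]]]; apply/gdist_joined.
by rewrite gE ?lexx ?L0// ltry.
Qed.

Lemma geodesic_left x y S : is_geodesic x y S -> S x.
Proof.
move=> gS; have [g [g0 _ _ ->]] := geodesic_param gS; exists 0 => //=.
by rewrite lexx rdist_ge0//; apply: geodesic_joined gS.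
Qed.

Lemma geodesic_right x y S : is_geodesic x y S -> S y.
Proof.
move=> gS; have [g [_ gL _ ->]] := geodesic_param gS.
exists (rdist x y) => //=.
by rewrite lexx rdist_ge0//; apply: geodesic_joined gS.
Qed.

(** Made total by the default [vx u]. The trivial equation lets [h] serve as the proof required by
    [is_point]. *)
Definition edge_point u v t : pt :=
  match pselect [/\ adj u v, 0 <= t <= 1 & bary u v t = bary u v t] with
  | left h => Point (or_intror (ex_intro _ u (ex_intro _ v (ex_intro _ t h))))
  | right _ => vx u
  end.

Lemma on_edge_point u v t : adj u v -> 0 <= t <= 1 ->
  on_edge (edge_point u v t) u v t.
Proof. by move=> uv t01; rewrite /edge_point; case: pselect => // -[]. Qed.

Lemma edge_point0 u v : edge_point u v 0 = vx u.
Proof.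
rewrite /edge_point; case: pselect => // h.
by apply: point_eq; rewrite /= bary0.
Qed.

Lemma vertex_geodesic u v : linked u v -> exists S, is_geodesic (vx u) (vx v) S.
Proof.
move=> uv; have [p [up pv pn]] := vdist_walk uv.
set n := vdist u v in pn.
pose q i := nth u (u :: p) i.
have adjq i : (i < n)%N -> adj (q i) (q i.+1).
  by move=> ni; apply: (pathP u up); rewrite pn.
have walkq i k : (i + k <= n)%N -> walk k (q i) (q (i + k)%N).
  elim: k => [|k IH] ik; first by rewrite addn0; apply: walk0.
  rewrite addnS -addn1; apply: walk_cat (IH _) _; first by lia.
  by apply: walk1; apply: adjq; lia.
(* At [s = n] the vertex [q n.+1] is only the default of [nth], but the offset is 0 and [edge_point]
   then gives [q n] with or without an edge. *)
pose g s := let i := Num.truncn s in edge_point (q i) (q i.+1) (s - i%:R).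
have gnat i : g i%:R = vx (q i) by rewrite /g natrK subrr edge_point0.
have gon i s : (i < n)%N -> i%:R <= s < i%:R + 1 ->
    on_edge (g s) (q i) (q i.+1) (s - i%:R).
  move=> ni si; rewrite /g (_ : Num.truncn s = i); last first.
    by apply: truncn_def; rewrite -natr1.
  by apply: on_edge_point; [exact: adjq|lra].
have gstart i s : (i <= n)%N -> i%:R <= s < i%:R + 1 -> s <= n%:R ->
    route (vx (q i)) (g s) (s - i%:R).
  rewrite leq_eqVlt => /orP[/eqP ->|ni] si sn.
    have -> : s = n%:R by lra.
    by rewrite gnat subrr; apply: route_nil.
  have := route_edge (on_edge0 R (adjq i ni)) (gon i s ni si).
  by rewrite sub0r normrN ger0_norm//; lra.
have groute s t : 0 <= s -> s <= t -> t <= n%:R -> route (g s) (g t) (t - s).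
  move=> s0 st tn.
  have t0 : 0 <= t by lra.
  have si := truncn_itv s0; have tj := truncn_itv t0.
  have ij := le_truncn st.
  set i := Num.truncn s in si ij; set j := Num.truncn t in tj ij.
  have jn : (j <= n)%N by rewrite -(ler_nat R); lra.
  rewrite -natr1 in si; rewrite -natr1 in tj.
  move: ij; rewrite leq_eqVlt => /orP[/eqP ij|ij].
    move: jn; rewrite leq_eqVlt => /orP[/eqP jn|jn].
      have -> : s = t by rewrite ij jn in si; rewrite jn in tj; lra.
      by rewrite subrr; apply: route_nil.
    rewrite ij in si; have := route_edge (gon j s jn si) (gon j t jn tj).
    have -> : s - j%:R - (t - j%:R) = - (t - s) by ring.
    by rewrite normrN ger0_norm// subr_ge0.
  (* Different edges: the rest of the edge of [s], then whole edges, then the beginning of the edge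
     of [t]. *)
  have ni : (i < n)%N by lia.
  have r1 := route_edge (gon i s ni si) (on_edge1 R (adjq i ni)).
  have := route_walk R (walkq i.+1 (j - i.+1)%N _).
  rewrite subnKC// => /(_ jn) r2; have r3 := gstart j t jn tj tn.
  have := route_cat (route_cat r1 r2) r3; congr route.
  rewrite distrC ger0_norm ?natrB// -?natr1; [ring|lra].
have g0 : g 0 = vx u by rewrite (gnat 0%N).
have gn : g n%:R = vx v by rewrite gnat /q -pn -last_nth pv.
(* No shortcut exists between [s] and [t], since the whole curve already has the minimal length
   [n]. *)
have gdistE' s t : 0 <= s -> s <= t -> t <= n%:R ->
    gdist (g s) (g t) = (t - s)%:E.
  move=> s0 st tn; have r := groute s t s0 st tn.
  have jst : joined (g s) (g t) by exists (t - s).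
  have r1 : route (g 0) (g s) (s - 0) by apply: groute; lra.
  have r2 : route (g t) (g n%:R) (n%:R - t) by apply: groute; lra.
  have j1 : joined (g 0) (g s) by exists (s - 0).
  have j2 : joined (g t) (g n%:R) by exists (n%:R - t).
  rewrite gdistE//; congr EFin; apply/eqP; rewrite eq_le (rdist_le r)/=.
  have := rdist_triangle j1 (joined_trans jst j2).
  have := rdist_triangle jst j2; have := rdist_le r1; have := rdist_le r2.
  by rewrite g0 gn (rdist_vertex R uv) -/n; lra.
exists [set g s | s in [set s | 0 <= s <= n%:R]], n%:R, g.
split=> // s t /andP[s0 sn] /andP[t0 tn].
have [st|/ltW ts] := leP s t.
  by rewrite gdistE'// distrC ger0_norm// subr_ge0.
rewrite ger0_norm ?subr_ge0//.
have [jt tE] := gdist_fin (gdistE' _ _ t0 ts sn).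
by rewrite (gdistE (joined_sym jt)) rdist_sym tE.
Qed.

End Geodesics.

(** * Thin triangles and the four-point inequality *)

Section ThinTriangles.
Variables (R : realType) (G : sgraph).
Local Notation pt := (Defs.point R G).
Local Notation vx := (@vertex_point R G).
Implicit Types (p q x y z : pt) (u v w : G) (s t l m : R) (S A B C : set pt).

Lemma lt_pinfty_bound (e : \bar R) : (e < +oo)%E ->
  exists2 d : R, 0 <= d & (e < d%:E)%E.
Proof.
case: e => [r _| |_] //; last by exists 0; rewrite ?ltNyr.
by exists (`|r| + 1); rewrite ?addr_ge0// lte_fin; have := ler_norm r; lra.
Qed.

Lemma rdist_near_vertex x y u v : joined x y ->
  joined x (vx u) -> rdist x (vx u) <= 1 ->
  joined y (vx v) -> rdist y (vx v) <= 1 ->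
  [/\ linked u v, rdist x y <= (vdist u v)%:R + 2
    & (vdist u v)%:R <= rdist x y + 2].
Proof.
move=> xy xu xu1 yv yv1.
have xv := joined_trans xy yv; have uv := joined_trans (joined_sym xu) xv.
have luv := joined_linked uv; rewrite -(rdist_vertex R luv); split=> //.
  have := rdist_triangle xu (joined_trans uv (joined_sym yv)).
  have := rdist_triangle uv (joined_sym yv).
  by rewrite (rdist_sym (vx v) y); lra.
have := rdist_triangle (joined_sym xu) xv.
have := rdist_triangle xy yv.
by rewrite (rdist_sym (vx u) x); lra.
Qed.

(** Replacing each point by a vertex within 1 changes each distance by at most 2; the four distances
    in an alternative account for the 8. *)
Lemma fourpoint_points c : fourpoint G c -> forall x y z t : pt,
  joined x y -> joined x z -> joined x t ->
  rdist x y + rdist z t <= rdist x z + rdist y t + (c%:R + 8) \/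
  rdist x y + rdist z t <= rdist x t + rdist y z + (c%:R + 8).
Proof.
move=> fp x y z t xy xz xt.
have zt := joined_trans (joined_sym xz) xt.
have yt := joined_trans (joined_sym xy) xt.
have yz := joined_trans (joined_sym xy) xz.
have [x' jx dx] := near_vertex x; have [y' jy dy] := near_vertex y.
have [z' jz dz] := near_vertex z; have [t' jt dt] := near_vertex t.
have [lxy ? ?] := rdist_near_vertex xy jx dx jy dy.
have [lxz ? ?] := rdist_near_vertex xz jx dx jz dz.
have [lxt ? ?] := rdist_near_vertex xt jx dx jt dt.
have [_ ? ?] := rdist_near_vertex yz jy dy jz dz.
have [_ ? ?] := rdist_near_vertex yt jy dy jt dt.
have [_ ? ?] := rdist_near_vertex zt jz dz jt dt.
have := fp _ _ _ _ lxy lxz lxt; rewrite addn_maxl leq_max.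
by case/orP; rewrite -(ler_nat R) !natrD => ?; [left|right]; lra.
Qed.

(** Take [q] at distance [rdist p a] from [a]: the inequality for [p, q, a, b] bounds [rdist p q] by
    [k] or by [2 * k]. If [p] is farther from [a] than [b] is, [b] itself is close to [p]. *)
Lemma near_geodesic k a b S p :
  (forall x y z t : pt, joined x y -> joined x z -> joined x t ->
    rdist x y + rdist z t <= rdist x z + rdist y t + k \/
    rdist x y + rdist z t <= rdist x t + rdist y z + k) ->
  is_geodesic a b S -> joined p a -> rdist p a + rdist p b <= rdist a b + k ->
  exists q, [/\ S q, joined p q & rdist p q <= 2 * k].
Proof.
move=> fp gS pa near; have ab := geodesic_joined gS.
have pb := joined_trans pa ab.
have pa0 := rdist_ge0 pa; have pb0 := rdist_ge0 pb.
have := rdist_triangle (joined_sym pa) pb; rewrite (rdist_sym a p) => tri.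
have [le|lt] := leP (rdist p a) (rdist a b).
  have [|q [Sq aq qb aqE qbE]] := @geodesic_point _ _ _ _ _ (rdist p a) gS.
    by rewrite pa0.
  exists q; have pq := joined_trans pa aq; split=> //.
  have := fp p q a b pq pa pb.
  by rewrite (rdist_sym q a); case=> ?; lra.
exists b; split; [exact: geodesic_right gS|by []|lra].
Qed.

Lemma fourpoint_hyperbolic c : fourpoint G c -> hyperbolic R G.
Proof.
move=> /fourpoint_points; set k := c%:R + 8 => fp.
have k0 : 0 <= k by rewrite addr_ge0.
have thin1 A B C x y z : is_geodesic x y A -> is_geodesic y z B ->
    is_geodesic z x C -> A `<=` neighborhood (B `|` C) (2 * k).
  move=> gA gB gC p Ap.
  have [xp py xpy] := geodesic_mem gA Ap.
  have zx := geodesic_joined gC; have yz := geodesic_joined gB.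
  have zp := joined_trans zx xp; have zy := joined_sym yz.
  suff [q [BCq pq pqk]] :
      exists q, [/\ (B `|` C) q, joined p q & rdist p q <= 2 * k].
    apply: ge_ereal_inf; exists (gdist p q); first by exists q.
    by rewrite gdistE// lee_fin.
  (* Since [p] lies between [x] and [y], the alternatives say that [p] is nearly between [z] and
     [x], or nearly between [z] and [y]. *)
  have [h|h] := fp z p x y zp zx zy.
    have [|q [? ? ?]] := near_geodesic fp gC (joined_sym zp).
    - by rewrite (rdist_sym p z) (rdist_sym p x); lra.
    - by exists q; split=> //; right.
  have [|q [? ? ?]] := near_geodesic fp gB py.
  - rewrite (rdist_sym p x) in h.
    by rewrite (rdist_sym p z) (rdist_sym y z); lra.
  - by exists q; split=> //; left.
apply: le_lt_trans (ltry (2 * k)).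
apply: ge_ereal_sup => _ [x0 _ <-]; apply: ge_ereal_sup => _ [A [B [C [T ->]]]].
case: T => _ _ _ [x [y [z [gA gB gC]]]].
apply: ge_ereal_inf; exists (2 * k)%:E => //; exists (2 * k) => //.
split; first by rewrite mulr_ge0.
by split; [exact: thin1 gA gB gC|exact: thin1 gB gC gA|exact: thin1 gC gA gB].
Qed.

Definition slim (d : R) : Prop := forall x y z A B C, is_geodesic x y A ->
  is_geodesic y z B -> is_geodesic z x C -> forall p, A p ->
  exists q, [/\ (B `|` C) q, joined p q & rdist p q <= d].

(** Taking [d] strictly above [delta] makes the infima yield an actual point [q]. *)
Lemma hyperbolic_slim : hyperbolic R G -> exists2 d, 0 <= d & slim d.
Proof.
move=> hyp; have [d d0 dH] := lt_pinfty_bound hyp.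
exists d => // x y z A B C gA gB gC p Ap.
have sub a b S : joined x a -> is_geodesic a b S -> S `<=` component x.
  move=> xa gS q /(geodesic_mem gS)[aq _ _].
  by apply/gdist_joined; apply: joined_trans aq.
have xy := geodesic_joined gA; have yz := geodesic_joined gB.
have : (delta_triangle A B C < d%:E)%E.
  apply: le_lt_trans dH.
  apply: (@le_trans _ _ (delta_set (component x))); last first.
    by apply: ereal_sup_ubound; exists x.
  apply: ereal_sup_ubound; exists A, B, C; split=> //.
  split; last by exists x, y, z.
  - exact: sub (joined_refl x) gA.
  - exact: sub xy gB.
  - exact: sub (joined_trans xy yz) gC.
case/ereal_inf_lt => _ [e [e0 [thinA _ _]] <-] ed.
have := le_lt_trans (thinA p Ap) ed.
case/ereal_inf_lt => _ [q BCq <-] pq.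
have jpq : joined p q by apply/gdist_joined; apply: lt_trans pq (ltry d).
exists q; split=> //; move: pq.
by rewrite gdistE// lte_fin; apply: ltW.
Qed.

Lemma geodesic_detour a b S p q e : is_geodesic a b S -> S q -> joined p q ->
  rdist p q <= e -> rdist a p + rdist p b <= rdist a b + 2 * e.
Proof.
move=> gS Sq pq pqe; have [aq qb <-] := geodesic_mem gS Sq.
have := rdist_triangle aq (joined_sym pq); have := rdist_triangle pq qb.
by rewrite (rdist_sym q p); lra.
Qed.

(* Walking along the side [S] of a slim triangle with apex [p], one passes
   from the neighbourhood of one other side to that of the remaining one *)
Lemma slim_apex d u v w S : 0 <= d -> slim d -> linked u w -> linked v w ->
  is_geodesic (vx u) (vx v) S ->
  exists2 q, S q & 2 * rdist (vx w) q <=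
    rdist (vx w) (vx u) + rdist (vx w) (vx v) - rdist (vx u) (vx v)
    + 2 * (d + (d + 1)).
Proof.
move=> d0 sl xw zw gS.
have [B gB] := vertex_geodesic R zw.
have [C gC] := vertex_geodesic R (linked_sym xw).
have jxz := geodesic_joined gS.
have lxz := joined_linked jxz.
have jxw := geodesic_joined gC; have jwz := joined_sym (geodesic_joined gB).
suff [q [Sq [b [Bb qb dqb]] [e [Ce qe dqe]]]] : exists q, [/\ S q,
    exists b, [/\ B b, joined q b & rdist q b <= d + 1] &
    exists e, [/\ C e, joined q e & rdist q e <= d]].
  exists q => //; have [xq qz <-] := geodesic_mem gS Sq.
  have := geodesic_detour gC Ce qe dqe; have := geodesic_detour gB Bb qb dqb.
  rewrite (rdist_sym _ q) (rdist_sym (vx v)) (rdist_sym q (vx u)).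
  by rewrite (rdist_sym q (vx w)); lra.
have [g [g0 gL gE SE]] := geodesic_param gS.
move: (gL) gE SE; rewrite rdist_vertex//; set n := vdist u v => gn gE SE.
have Sg i : (i <= n)%N -> S (g i%:R).
  by move=> ni; rewrite SE; exists i%:R => //=; rewrite ler0n ler_nat.
(* Integer parameters replace a connectedness argument: where [P i] holds and [P i.+1] fails, the
   next sample is near [B], and the step between the samples costs the 1 in [d + 1]. If [P n] holds,
   the end [v] serves, as it lies on [B]. *)
pose P i := exists e, [/\ C e, joined (g i%:R) e & rdist (g i%:R) e <= d].
have P0 : P 0%N.
  exists (vx u); split; first exact: geodesic_right gC.
    by rewrite g0; apply: joined_refl.
  by rewrite g0 rdist_refl.
have [Pn|nPn] := pselect (P n).
  exists (g n%:R); split; [exact: Sg| |exact: Pn].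
  exists (vx v); rewrite gn; split; first exact: geodesic_left gB.
    exact: joined_refl.
  by rewrite rdist_refl addr_ge0.
have [i [ni Pi nPi]] : exists i, [/\ (i < n)%N, P i & ~ P i.+1].
  elim: (n) nPn => [//|m IH] nPm.
  have [Pm|/IH[i [im Pi nPi]]] := pselect (P m); first by exists m.
  by exists i; split=> //; apply: ltnW.
exists (g i%:R); split; [exact/Sg/ltnW| |exact: Pi].
have [q [BCq iq dq]] := sl _ _ _ _ _ _ gS gB gC _ (Sg _ ni).
case: BCq => [Bq|Cq]; last by case: nPi; exists q.
have [||ii dii] := gE i%:R i.+1%:R.
- by rewrite ler0n ler_nat ltnW.
- by rewrite ler0n ler_nat.
exists q; split=> //; first exact: joined_trans iq.
by have := rdist_triangle ii iq; rewrite dii distrC -natrB// subSnn normr1; lra.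
Qed.

(** With Gromov products at [w], [slim_apex] gives [q] on [[xz]] with [d(w, q) <= (x|z) + 2d + 1].
    Some [q'] on another side, say [[zy]], is within [d] of [q], and [d(w, q') >= (z|y)] holds for
    any point of that side. Doubling gives [6d + 2]. *)
Lemma hyperbolic_fourpoint : hyperbolic R G -> exists c, fourpoint G c.
Proof.
move=> /hyperbolic_slim[d d0 sl].
have [c cE] : exists c : nat, 6 * d + 2 <= c%:R.
  by exists (Num.truncn (6 * d + 2)).+1; apply/ltW/truncnS_gt.
exists c.*2; apply: fourpoint_based => w; exists w; first exact: linked_refl.
move=> x y z xw yw zw.
have xz := linked_trans xw (linked_sym zw).
have [S gS] := vertex_geodesic R xz.
have [T gT] := vertex_geodesic R (linked_trans zw (linked_sym yw)).
have [U gU] := vertex_geodesic R (linked_trans yw (linked_sym xw)).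
have [q Sq qE] := slim_apex d0 sl xw zw gS.
have [q' [TUq qq' dqq']] := sl _ _ _ _ _ _ gS gT gU q Sq.
have wq : joined (vx w) q.
  have [xq _ _] := geodesic_mem gS Sq.
  exact: joined_trans (linked_joined R (linked_sym xw)) xq.
have wq' := joined_trans wq qq'.
have h1 := rdist_triangle wq qq'.
have ge u v V : linked u w -> is_geodesic (vx u) (vx v) V -> V q' ->
    rdist (vx u) (vx w) + rdist (vx w) (vx v) - rdist (vx u) (vx v)
    <= 2 * rdist (vx w) q'.
  move=> uw gV Vq; have := geodesic_detour gV Vq wq' (lexx _); lra.
have rv u v : linked u w -> linked v w -> rdist (vx u) (vx v) = (vdist u v)%:R.
  by move=> uw vw; apply/rdist_vertex/(linked_trans uw)/linked_sym.
have ww := linked_refl w.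
rewrite !rv// (vdist_sym w x) (vdist_sym w z) in qE.
rewrite addn_maxl leq_max; apply/orP.
case: TUq => [/(ge _ _ _ zw gT)|/(ge _ _ _ yw gU)]; rewrite !rv//.
  rewrite (vdist_sym w y) (vdist_sym z y) => h2; right.
  by rewrite -(ler_nat R) !natrD; lra.
rewrite (vdist_sym w x) (vdist_sym y x) => h2; left.
by rewrite -(ler_nat R) !natrD; lra.
Qed.

End ThinTriangles.

(** * The hypotheses of the theorem in terms of vertex distances *)

Section Hypotheses.
Variables (R : realType) (G : sgraph).
Local Notation vx := (@vertex_point R G).

Lemma connected_linked : connected_graph G -> forall u v : G, linked u v.
Proof.
by case=> _ conn u v; have [p [up pv]] := conn u v; exists (size p), p.
Qed.

Lemma nontrivial_edge : connected_graph G -> ~ trivial_graph G ->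
  exists a b : G, adj a b.
Proof.
move=> conn nontriv; have [[a] _] := conn; apply: contrapT => noedge.
apply: nontriv; exists a => b; have [n] := connected_linked conn a b.
case: n => [[[|? ?] [] //= _ <-] //|n /walkS[c ac _]].
by exfalso; apply: noedge; exists a, c.
Qed.

Lemma bounded_vdist : bounded_graph R G -> (forall u v : G, linked u v) ->
  exists D, forall u v : G, (vdist u v <= D)%N.
Proof.
move=> /lt_pinfty_bound[d d0 diam] conn; exists (Num.truncn d) => u v.
rewrite truncn_ge_nat// -(rdist_vertex R (conn u v)) -lee_fin -gdistE.
  apply: le_trans (ltW diam); apply: ereal_sup_ubound.
  by exists (vx u), (vx v).
exact: linked_joined.
Qed.

(** The ball may meet the cycle inside an edge only. The interpolated distance to [w] is below [K]
    at such a point and is a convex combination of its values at the ends of the edge, so these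
    cannot both exceed [K]. *)
Lemma cycle_near_vertex (w : G) (K : nat) (c : seq G) :
  cycle_points c `&` gball (vx w) K%:R !=set0 ->
  exists2 q, q \in c & (vdist q w <= K)%N.
Proof.
case=> x [[u [t [uc [_ t01 xE]]]] xw].
have jxw : joined x (vx w) by apply/gdist_joined/(lt_trans xw)/ltry.
move: xw; rewrite /gball /= gdistE// lte_fin => xw.
have : interp (fun v => (vdist v w)%:R) x < K%:R.
  apply: le_lt_trans xw; apply: le_rdist => // l.
  move=> /(interp_route (@vdist_lipschitz R G w)).
  by rewrite interp_vertex vdist_refl mul1r subr0; apply: le_trans (ler_norm _).
rewrite (interpE _ xE) => near.
have [h|h] := leqP (vdist u w) K; first by exists u.
exists (next c u); first by rewrite mem_next.
rewrite leqNgt; apply/negP => h'.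
move: h h'; rewrite -!(ltr_nat R) => h h'; nra.
Qed.

End Hypotheses.

Theorem corollary2p38 (R : realType) (G1 G2 : sgraph)
    (hG1 : connected_graph G1) (hG2 : connected_graph G2)
    (K : nat) (w : G1) (hK : (0 < K)%N)
    (hcyc : forall c : seq G1, odd_cycle c ->
       cycle_points c `&` gball (vertex_point R w) K%:R !=set0)
    (hnontriv : ~ trivial_graph G2)
    (hbounded : bounded_graph R G2)
    (hnoodd : ~ exists c : seq G2, odd_cycle c) :
  hyperbolic R (direct_product G1 G2) <-> hyperbolic R G1.
Proof.
have conn1 := connected_linked hG1; have conn2 := connected_linked hG2.
have [b0 [b1 b01]] := nontrivial_edge hG2 hnontriv.
have [D diam2] := bounded_vdist hbounded conn2.
have near c (oc : odd_cycle c) := cycle_near_vertex (hcyc c oc).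
split=> [/hyperbolic_fourpoint|/hyperbolic_fourpoint] fp.
  have [c] := fourpoint_fst w conn1 conn2 hnoodd diam2 b01 fp.
  exact: fourpoint_hyperbolic.
have [c] := fourpoint_prod conn1 conn2 near hnoodd diam2 b01 fp.
exact: fourpoint_hyperbolic.
Qed.
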